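(* Let $s\ge2$ and $1\le r\le s-1$. If $R\subset\mathbb N$ is a set of $r$-recurrence for all minimal $(s-1)$-step affine systems, then $R$ is a set of $r$-recurrence for all minimal $s$-step affine systems.
   Context: An affine system is $(\mathbb T^d,T)$ with $T(x)=Mx+\alpha \pmod 1$, where $M$ is a $d\times d$ integer matrix that is unipotent and $\alpha\in\mathbb T^d$; it is $k$-step if $(M-\mathrm{Id})^k=0$ (it is then a $k$-step nilsystem, realized via the group generated by $M$ and the translations of $\mathbb T^d$). Minimal means no proper nonempty closed invariant subset. $R$ is a set of $r$-recurrence for a class of minimal systems if for each system $(X,T)$ in the class and every nonempty open $U\subset X$ there is $n\in R$ with $U\cap T^{-n}U\cap\dots\cap T^{-rn}U\ne\emptyset$. *)

(* Defs.v *)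
From Stdlib Require Import Reals.
From mathcomp Require Import all_boot all_order all_algebra.
Set Implicit Arguments. Unset Strict Implicit. Unset Printing Implicit Defensive.

Definition int_to_R (z : int) : R :=
  match z with
  | Posz n => INR n
  | Negz n => Ropp (INR n.+1)
  end.

(* points of R^d; the torus T^d = R^d / Z^d is handled via Z^d-periodic sets *)
Definition vecR (d : nat) := 'I_d -> R.

Definition mxpow (d : nat) (N : 'M[int]_d) (k : nat) : 'M[int]_d :=
  iter k (fun P => mulmx N P) (1%:M)%R.

Definition unipotent (d : nat) (M : 'M[int]_d) : Prop :=
  mxpow (M - 1%:M)%R d = 0%R.

Definition k_step (k d : nat) (M : 'M[int]_d) : Prop :=
  mxpow (M - 1%:M)%R k = 0%R.

(* lift to R^d of the affine map T x = M x + alpha (mod 1) *)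
Definition affT (d : nat) (M : 'M[int]_d) (alpha : vecR d) (x : vecR d) : vecR d :=
  fun i => Rplus (\big[Rplus/R0]_(j < d) Rmult (int_to_R (M i j)) (x j)) (alpha i).

Definition shiftZ (d : nat) (x : vecR d) (z : 'I_d -> int) : vecR d :=
  fun i => Rplus (x i) (int_to_R (z i)).

(* Z^d-periodic subsets of R^d = subsets of T^d *)
Definition periodic (d : nat) (U : vecR d -> Prop) : Prop :=
  forall x z, U x -> U (shiftZ x z).

Definition openR (d : nat) (U : vecR d -> Prop) : Prop :=
  forall x, U x -> exists eps : R, Rlt R0 eps /\
    forall y : vecR d, (forall i, Rlt (Rabs (Rminus (y i) (x i))) eps) -> U y.

Definition closedR (d : nat) (F : vecR d -> Prop) : Prop :=
  openR (fun x => ~ F x).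

(* minimality of (T^d, T): every nonempty closed T-invariant subset of T^d
   (i.e. nonempty closed Z^d-periodic T-invariant subset of R^d) is everything *)
Definition minimal_affine (d : nat) (M : 'M[int]_d) (alpha : vecR d) : Prop :=
  forall F : vecR d -> Prop,
    closedR F -> periodic F -> (exists x, F x) ->
    (forall x, F x -> F (affT M alpha x)) ->
    forall x, F x.

Definition r_recurrent_for (Rset : nat -> Prop) (r d : nat)
    (M : 'M[int]_d) (alpha : vecR d) : Prop :=
  forall U : vecR d -> Prop,
    openR U -> periodic U -> (exists x, U x) ->
    exists n, Rset n /\ exists x, forall j, (j <= r)%N ->
      U (iter (j * n) (affT M alpha) x).

Definition recurrence_for_affine (Rset : nat -> Prop) (r k : nat) : Prop :=
  forall (d : nat) (M : 'M[int]_d) (alpha : vecR d),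
    unipotent M -> k_step k M -> minimal_affine M alpha ->
    r_recurrent_for Rset r M alpha.

(* Main.v *)
Require Import Defs.
From Stdlib Require Import Reals.
From mathcomp Require Import all_boot all_order all_algebra.
From Stdlib Require Import FunctionalExtensionality.
From mathcomp Require Import Rstruct ring lra zify.
Set Implicit Arguments. Unset Strict Implicit. Unset Printing Implicit Defensive.
Import Order.TTheory GRing.Theory Num.Theory.
Local Open Scope ring_scope.

Local Notation intr_mx := (map_mx intr).

(* Write s = k + 1, N = M - 1 and let V = N^k R^d, a rational subspace fixed
   pointwise by M.  The quotient of T^d by the subtorus V is a k-step affine
   system on a torus, minimal as a factor, so some n in R brings a point of a
   small set back at the times n, ..., rn.  An integer vector v with v N = 0
   gives a rotation factor by the irrational v . alpha, hence n can be forced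
   to be large.  Lifting to T^d yields x such that every T^(jn) x, j <= r, is
   close to the centre of U up to some J f_j in V with f_j bounded.  Moving x
   by u = sum_i n^-i N^(k-i) z_i, with z_i bounded, moves T^(jn) x by
   sum_i (j^i / i!) N^k z_i + O(1/n); as r <= k, Lagrange interpolation in j
   chooses the z_i so that this cancels all the J f_j. *)

(** * Integer matrices: nilpotency and quotient tori *)

Lemma intr_mx_inj (R : numDomainType) m n :
  injective (map_mx (intr : int -> R) : 'M_(m, n) -> 'M_(m, n)).
Proof.
move=> A B /matrixP eqAB; apply/matrixP=> i j.
by apply: (@intr_inj R); have := eqAB i j; rewrite !mxE.
Qed.

Lemma map_mxX (aR rR : pzRingType) (f : {rmorphism aR -> rR}) n
    (A : 'M[aR]_n) k : map_mx f (A ^+ k) = map_mx f A ^+ k.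
Proof.
elim: k => [|k IH]; first by rewrite !expr0 map_mx1.
by rewrite !exprS -IH; exact: map_mxM.
Qed.

(** The minimal polynomial over the rationals divides X^k, hence is a power X^m; it also divides the
    characteristic polynomial, so m <= n. This derives [unipotent] from a k-step condition. *)
Lemma nilpotent_mx_expr n k (A : 'M[int]_n) : A ^+ k = 0 -> A ^+ n = 0.
Proof.
case: n A => [|n] A Ak; first by apply/matrixP; case.
apply: (@intr_mx_inj rat); rewrite map_mxX map_mx0.
set B := map_mx _ _.
have Bk : B ^+ k = 0 by rewrite -map_mxX Ak map_mx0.
have : mxminpoly B %| ('X - 0%:P) ^+ k.
  by apply: mxminpoly_min; rewrite subr0 rmorphXn /= horner_mx_X.
case/dvdp_exp_XsubCP=> m [_ eqm].
have /eqP Bm : horner_mx B (('X - 0%:P) ^+ m) == 0.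
  by rewrite -dvd_mxminpoly (eqp_dvdl _ eqm).
rewrite subr0 rmorphXn /= horner_mx_X in Bm.
have le_m : (m <= n.+1)%N.
  have := eqp_size eqm; rewrite size_mxminpoly subr0 size_polyXn => -[<-].
  have := dvdp_leq _ (mxminpoly_dvd_char B).
  by rewrite size_char_poly size_mxminpoly monic_neq0 ?char_poly_monic //; apply.
have -> : B ^+ n.+1 = B ^+ (n.+1 - m) * B ^+ m by rewrite -exprD subnK.
by rewrite Bm mulr0.
Qed.

(* The columns of [S] and [J] come from a Smith basis of Z^d adapted to [A], so
   [P] is the projection of T^d onto its quotient by the subtorus [A R^d]. *)
Lemma image_torus_quotient (R : numFieldType) d (A : 'M[int]_d) :
  exists d' (P : 'M[int]_(d', d)) (S : 'M[int]_(d, d')) (J Q : 'M[int]_d)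
    (K : 'M[R]_d),
  [/\ P *m S = 1%:M, S *m P + J *m Q = 1%:M, P *m A = 0 &
      map_mx intr A *m K = map_mx intr J].
Proof.
have [L uL [W uW [e _ defA]]] := int_Smith_normal_form A.
set D := \matrix_(i, j) _ in defA.
(* [Z] indexes the zero diagonal entries of [D]: [P] and [S] keep those rows of L^-1 and columns of
   [L]. [E] projects onto the remaining indices, where [Dv] inverts [D]. *)
pose Z := [pred i : 'I_d | e`_i == 0].
pose g (i : 'I_#|Z|) : 'I_d := enum_val i.
pose E : 'M[int]_d := \matrix_(i, j) ((i == j) && (e`_i != 0))%:R.
pose Dv : 'M[R]_d := \matrix_(i, j) ((e`_i)%:~R^-1 *+ (i == j)).
exists #|Z|, (rowsub g (invmx L)), (colsub g L), (L *m E), (invmx L).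
exists (map_mx intr (invmx W) *m Dv); split.
- rewrite mul_rowsub_mx mulmx_colsub mulVmx //.
  apply/matrixP=> i j; rewrite !mxE.
  by rewrite (inj_eq enum_val_inj).
- rewrite -[RHS](mulmxV uL) -mulmxA.
  apply/matrixP=> i j; rewrite !mxE.
  under [X in X + _]eq_bigr do rewrite !mxE.
  rewrite -(big_enum_val (A := Z) (fun l => L i l * invmx L l j)) /=.
  rewrite big_mkcond -big_split /=; apply: eq_bigr => l _.
  rewrite !mxE (bigD1 l) //= !mxE eqxx /= big1 ?addr0.
    by rewrite inE; case: eqP => _ /=; ring.
  by move=> m ml; rewrite !mxE eq_sym (negPf ml) /= mul0r.
- rewrite defA !mulmxA mul_rowsub_mx mulVmx //.
  apply/matrixP=> i j; rewrite !mxE big1 // => l _.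
  rewrite !mxE (bigD1 (g i)) //= big1 => [|m /negPf mi].
    rewrite !mxE eqxx mul1r addr0.
    have := enum_valP i; rewrite inE => /eqP ->.
    by rewrite mul0rn mul0r.
  by rewrite !mxE eq_sym mi mul0r.
- rewrite mulmxA -[X in X *m _]map_mxM {}defA mulmxK // !map_mxM -mulmxA; congr (_ *m _).
  apply/matrixP=> i j; rewrite !mxE (bigD1 i) //= big1 ?addr0; last first.
    by move=> l li; rewrite !mxE eq_sym [(_ == _ :> nat)](negPf li) mulr0n mul0r.
  rewrite !mxE eqxx mulr1n; case: (i == j) => /=; last by rewrite mulr0n mulr0.
  rewrite mulr1n; case: eqP => [->|/eqP nz] /=; first by rewrite mul0r.
  by rewrite divff ?intr_eq0.
Qed.

(** * Binomial growth and O(1/n) estimates *)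

Lemma ffact_le_expn m l : (m ^_ l <= m ^ l)%N.
Proof.
elim: l => [|l IH]; first by rewrite ffactn0.
by rewrite ffactnSr expnSr leq_mul // leq_subr.
Qed.

(** Passing from l to l + 1 costs one more l * m^l, and l^2 + l <= (l + 1)^2. With [ffact_le_expn]
    this isolates the leading term of the falling factorial. *)
Lemma expn_le_ffact m l : (m ^ l <= m ^_ l + l ^ 2 * m ^ l.-1)%N.
Proof.
elim: l => [|l IH]; first by rewrite ffactn0.
have le_ff := ffact_le_expn m l.
(* At l = 0 the exponent [l.-1] is off by one, but the factor [l ^ 2] vanishes. *)
have step : (l ^ 2 * (m ^ l.-1 * m) = l ^ 2 * m ^ l)%N.
  by case: (l) => [|l'] //; rewrite -expnSr.
have := leq_mul IH (leqnn m); rewrite -expnSr mulnDl -mulnA step => /leq_trans.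
apply; rewrite ffactnSr /=.
have : (m <= (m - l) + l)%N by lia.
move=> /(leq_mul (leqnn (m ^_ l))) le1.
have le2 : (m ^_ l * l <= m ^ l * l)%N by rewrite leq_mul.
move: le1 le2; rewrite mulnDr; nia.
Qed.

Definition cv_le (R : realFieldType) d (x : 'cV[R]_d) (c : R) :=
  forall i, `|x i 0| <= c.

Definition vanishing_coef (R : realFieldType) (c : nat -> R) :=
  exists C, forall n, (0 < n)%N -> `|c n| <= C / n%:R.

(* [O(1/n)], uniformly over the bounded families [f] with [f 0 = 0]. *)
Definition vanishing (R : realFieldType) d
    (g : nat -> (nat -> 'cV[R]_d) -> 'cV[R]_d) :=
  exists C, forall n f, (0 < n)%N -> f 0%N = 0 ->
    (forall j, cv_le (f j) 1) -> cv_le (g n f) (C / n%:R).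

Section Vanishing.
Variables (R : realFieldType) (d : nat).
Implicit Types (c : nat -> R) (g : nat -> (nat -> 'cV[R]_d) -> 'cV[R]_d).

Lemma eq_vanishing g1 g2 :
  (forall n f, (0 < n)%N -> f 0%N = 0 -> g1 n f = g2 n f) ->
  vanishing g1 -> vanishing g2.
Proof.
by move=> eqg [C gC]; exists C => n f n0 f0 fP; rewrite -eqg //; apply: gC.
Qed.

Lemma vanishing_add g1 g2 : vanishing g1 -> vanishing g2 ->
  vanishing (fun n f => g1 n f + g2 n f).
Proof.
move=> [C1 g1C] [C2 g2C]; exists (C1 + C2) => n f n0 f0 fP i.
rewrite mxE mulrDl (le_trans (ler_normD _ _)) // lerD //.
  exact: g1C.
exact: g2C.
Qed.

Lemma vanishing0 : vanishing (fun _ _ => 0 : 'cV[R]_d).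
Proof. by exists 0 => n f n0 f0 fP i; rewrite mxE normr0 mul0r. Qed.

Lemma vanishing_sum (I : finType) (G : I -> nat -> (nat -> 'cV[R]_d) -> 'cV[R]_d) :
  (forall i, vanishing (G i)) -> vanishing (fun n f => \sum_i G i n f).
Proof.
move=> GP.
suff: forall s : seq I, vanishing (fun n f => \sum_(i <- s) G i n f) by apply.
elim=> [|i s IH].
  by apply: eq_vanishing vanishing0 => n f _ _; rewrite big_nil.
by apply: eq_vanishing (vanishing_add (GP i) IH) => n f _ _; rewrite big_cons.
Qed.

Lemma cv_le_mulmx m (B : 'M[R]_(m, d)) :
  exists2 b, 0 <= b & forall x e, cv_le x e -> cv_le (B *m x) (b * e).
Proof.
exists (\sum_i \sum_j `|B i j|).
  by apply: sumr_ge0 => i _; apply: sumr_ge0.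
move=> x e xe i; rewrite mxE (le_trans (ler_norm_sum _ _ _)) //.
have e0 (j : 'I_d) : 0 <= e by apply: le_trans (xe j).
rewrite (bigD1 i) //= mulrDl mulr_suml ler_wpDr //.
  rewrite mulr_suml; apply: sumr_ge0 => i' _.
  by rewrite mulr_suml; apply: sumr_ge0 => j _; rewrite mulr_ge0 // e0.
by apply: ler_sum => j _; rewrite normrM ler_wpM2l.
Qed.

Lemma vanishing_scale c (B : 'M[R]_d) j : vanishing_coef c ->
  vanishing (fun n f => c n *: (B *m f j)).
Proof.
move=> [C cC]; have [b b0 bP] := cv_le_mulmx B.
exists (C * b) => n f n0 f0 fP i.
rewrite mxE normrM mulrAC ler_pM ?cC //.
by rewrite -[b]mulr1; apply: bP.
Qed.

Lemma vanishing_coefM c a : vanishing_coef c -> vanishing_coef (fun n => a * c n).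
Proof.
move=> [C cC]; exists (`|a| * C) => n n0.
by rewrite normrM -mulrA ler_wpM2l // cC.
Qed.

(** The binomial coefficient is at most (j n)^l, so dividing by n^i leaves at least one factor
    1/n. *)
Lemma vanishing_coef_bin_lt j l i : (l < i)%N ->
  vanishing_coef (fun n => 'C(j * n, l)%:R / n%:R ^+ i : R).
Proof.
move=> li; exists (j%:R ^+ l) => n n0.
have n0' : 0 < n%:R :> R by rewrite ltr0n.
rewrite ger0_norm ?divr_ge0 ?exprn_ge0 //.
rewrite ler_pdivrMr ?exprn_gt0 // -(subnKC li) exprD exprSr.
have -> : j%:R ^+ l / n%:R * (n%:R ^+ l * n%:R * n%:R ^+ (i - l.+1))
  = j%:R ^+ l * n%:R ^+ l * n%:R ^+ (i - l.+1) :> R.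
  by field; rewrite gt_eqF.
apply: le_trans (_ : (j * n)%:R ^+ l <= _).
  rewrite -natrX ler_nat; apply: leq_trans (ffact_le_expn _ _).
  by rewrite -bin_ffact leq_pmulr // fact_gt0.
rewrite natrM exprMn ler_peMr ?mulr_ge0 ?exprn_ge0 //.
by rewrite exprn_ege1 // ler1n.
Qed.

(** The leading term of the binomial coefficient is (j n)^(i+1) / (i+1)!; by [expn_le_ffact] the
    error is O(n^i), one power below the divisor. *)
Lemma vanishing_coef_bin_eq j i :
  vanishing_coef
    (fun n => 'C(j * n, i.+1)%:R / n%:R ^+ i.+1 - j%:R ^+ i.+1 / i.+1`!%:R : R).
Proof.
exists ((i.+1 ^ 2)%:R * j%:R ^+ i) => n n0.
have n0' : 0 < n%:R :> R by rewrite ltr0n.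
have f0 : 0 < i.+1`!%:R :> R by rewrite ltr0n fact_gt0.
set c := _ - _.
have defc : c = ((j * n) ^_ i.+1)%:R / (i.+1`!%:R * n%:R ^+ i.+1)
              - (j * n)%:R ^+ i.+1 / (i.+1`!%:R * n%:R ^+ i.+1).
  rewrite /c -bin_ffact (natrM _ 'C(_, _)) (natrM _ j) exprMn.
  move: f0; move: (i.+1`!%:R) => b b0; field.
  by rewrite ?expf_neq0 ?(gt_eqF b0) ?(gt_eqF n0').
rewrite defc -mulrBl normrM distrC normfV !ger0_norm; last first.
- by rewrite subr_ge0 -natrX ler_nat ffact_le_expn.
- by rewrite mulr_ge0 ?exprn_ge0.
rewrite ler_pdivrMr ?mulr_gt0 ?exprn_gt0 //.
apply: le_trans (_ : (i.+1 ^ 2)%:R * (j * n)%:R ^+ i <= _).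
  rewrite -!natrX -natrM lerBlDl -natrD ler_nat.
  exact: expn_le_ffact.
rewrite natrM exprMn exprS.
have f1 : 1 <= i.+1`!%:R :> R by rewrite ler1n fact_gt0.
move: f1 {f0 c defc}; move: (i.+1`!%:R) => b b1.
have -> : (i.+1 ^ 2)%:R * j%:R ^+ i / n%:R * (b * (n%:R * n%:R ^+ i))
  = b * ((i.+1 ^ 2)%:R * (j%:R ^+ i * n%:R ^+ i)) :> R.
  by field; rewrite gt_eqF.
rewrite ler_peMl //.
by rewrite !mulr_ge0 // exprn_ge0.
Qed.

End Vanishing.

(** * Interpolation and correction of orbits *)

(** Normalized product over the nodes 0, ..., r other than k. As k > 0, the node 0 is a root, so
    only the powers j, ..., j^r occur. *)
Lemma lagrange_basis (F : numFieldType) r (k : nat) : (0 < k <= r)%N ->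
  exists p : {poly F}, [/\ (size p <= r.+1)%N, p.[0] = 0 &
    forall j, (j <= r)%N -> p.[j%:R] = (j == k)%:R].
Proof.
move=> /andP[k0 kr].
pose q : {poly F} := \prod_(m < r.+1 | m != k :> nat) ('X - m%:R%:P).
have qE x : q.[x] = \prod_(m < r.+1 | m != k :> nat) (x - m%:R).
  by rewrite horner_prod; apply: eq_bigr => m _; rewrite !hornerE.
have qk : q.[k%:R] != 0.
  rewrite qE; apply/prodf_neq0 => m mk.
  by rewrite subr_eq0 eqr_nat eq_sym.
have q0 j : (j <= r)%N -> j != k -> q.[j%:R] = 0.
  rewrite -ltnS => jr jk; rewrite qE (bigD1 (Ordinal jr)) //=.
  by rewrite subrr mul0r.
exists (q.[k%:R]^-1 *: q); split.
- apply: leq_trans (size_scale_leq _ _) _.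
  apply: leq_trans (size_poly_prod_leq _ _) _.
  under eq_bigr do rewrite size_XsubC.
  rewrite sum_nat_const; set c := #|_|.
  suff : (c <= r)%N by lia.
  have kr' : (k < r.+1)%N by [].
  rewrite -[X in (_ <= X)%N]/(r.+1.-1) -(card_ord r.+1) -(cardC1 (Ordinal kr')).
  by apply/subset_leq_card/subsetP=> m; rewrite !inE.
- by rewrite hornerZ (q0 0%N) ?mulr0 // eq_sym -lt0n.
- move=> j jr; rewrite hornerZ; case: eqVneq => [->|jk].
    by rewrite mulVf.
  by rewrite (q0 j) ?mulr0.
Qed.

Lemma unipotent_mx_expr (R : comPzRingType) d k (N : 'M[R]_d) m : N ^+ k.+1 = 0 ->
  (1 + N) ^+ m = \sum_(l < k.+1) N ^+ l *+ 'C(m, l).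
Proof.
move=> Nk; elim: m => [|m IH].
  by rewrite expr0 big_ord_recl big1 ?addr0 // expr0.
rewrite exprS mulrDl mul1r {}IH [in X in _ + X]mulr_sumr.
rewrite [X in X + _]big_ord_recl [RHS]big_ord_recl !bin0 -addrA; congr (_ + _).
rewrite big_ord_recr /= mulrnAr -exprS Nk mul0rn addr0 -big_split.
by apply: eq_bigr => l _; rewrite /= mulrnAr -exprS -mulrnDr -binS.
Qed.

(* Since [N^+(k - i)] is followed by at most [i] further factors [N], a
   perturbation of size [n^-i] in its image is moved at time [j * n] by
   [j^i / i`!] times a vector of [N^+k], up to lower order terms; Lagrange
   interpolation in [j] then prescribes the displacements [- N^+k K f j]. *)
Lemma orbit_correction (R : realFieldType) d k r (N K : 'M[R]_d) :
  (r <= k)%N -> N ^+ k.+1 = 0 ->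
  exists C, forall n (f : nat -> 'cV[R]_d), (0 < n)%N -> f 0%N = 0 ->
    (forall j, cv_le (f j) 1) ->
    exists u, forall j, (j <= r)%N ->
      cv_le ((1 + N) ^+ (j * n) *m u + N ^+ k *m K *m f j) (C / n%:R).
Proof.
move=> rk Nk.
have [W WP] : exists W : 'I_r -> {poly R}, forall i : 'I_r,
    [/\ (size (W i) <= r.+1)%N, (W i).[0] = 0 &
     forall j, (j <= r)%N -> (W i).[j%:R] = (j == i.+1)%:R].
  have H (i : 'I_r) : (0 < i.+1 <= r)%N by rewrite ltn_ord.
  exact: (fin_all_exists (fun i => lagrange_basis R (H i))).
(* Index i stands for exponent i + 1. With this [b], the sum over i of [- b i l] j^(i+1) / (i+1)! is
   [W l] at j, which is 1 at j = l + 1 and 0 at the other nodes. *)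
pose b (i l : 'I_r) := - (i.+1`!%:R * (W l)`_i.+1).
pose u n (f : nat -> 'cV[R]_d) := \sum_(i < r) \sum_(l < r)
  (b i l / n%:R ^+ i.+1) *: (N ^+ (k - i.+1) *m K *m f l.+1).
pose G (j : 'I_r.+1) n (f : nat -> 'cV[R]_d) :=
  (1 + N) ^+ (j * n) *m u n f + N ^+ k *m K *m f j.
have GP j : vanishing (G j).
  (* Three regimes: for m < i + 1 the coefficient is O(1/n); for m = i + 1 it is so once its limit
     is subtracted; for m > i + 1 the matrix [B i m] has at least k + 1 factors [N] and vanishes. *)
  pose c (i l : 'I_r) (m : 'I_k.+1) n : R := b i l *
    ('C(j * n, m)%:R / n%:R ^+ i.+1 -
     (m == i.+1 :> nat)%:R * (j%:R ^+ i.+1 / i.+1`!%:R)).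
  pose B (i : 'I_r) (m : 'I_k.+1) := N ^+ m *m N ^+ (k - i.+1) *m K.
  apply: (@eq_vanishing _ _ (fun n f => \sum_(i < r) \sum_(l < r)
    \sum_(m < k.+1) c i l m n *: (B i m *m f l.+1))); last first.
    apply: vanishing_sum => i; apply: vanishing_sum => l.
    apply: vanishing_sum => m; rewrite /c.
    case: (ltngtP m i.+1) => [lt_m|gt_m|eq_m].
    - apply: vanishing_scale; apply: vanishing_coefM.
      have [C CP] := vanishing_coef_bin_lt R j lt_m.
      by exists C => n n0; rewrite mul0r subr0; apply: CP.
    - apply: eq_vanishing (vanishing0 _ _) => n f n0 _.
      rewrite /B; have -> : N ^+ m *m N ^+ (k - i.+1) = 0.
        rewrite -[LHS]exprD.
        have -> : (m + (k - i.+1) = k.+1 + (m - i.+2))%N.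
          by have := ltn_ord i; lia.
        by rewrite exprD Nk mul0r.
      by rewrite !mul0mx scaler0.
    - apply: vanishing_scale; apply: vanishing_coefM.
      have [C CP] := vanishing_coef_bin_eq R j i.
      by exists C => n n0; rewrite mul1r eq_m; apply: CP.
  move=> n f n0 f0; rewrite /G.
  (* Interpolation writes the target as the same triple sum, with only m = i + 1 contributing, so
     both sums merge termwise. *)
  have -> : N ^+ k *m K *m f j = \sum_(i < r) \sum_(l < r) \sum_(m < k.+1)
     (- b i l * (m == i.+1 :> nat)%:R * (j%:R ^+ i.+1 / i.+1`!%:R)) *:
     (B i m *m f l.+1).
    under eq_bigr => i _.
      under eq_bigr => l _.
        rewrite (bigD1 (Ordinal (leq_trans (ltn_ord i) rk : (i.+1 < k.+1)%N))) //=.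
        rewrite big1 => [|m /negPf mi]; last first.
          by rewrite -val_eqE /= in mi; rewrite mi mulr0 mul0r scale0r.
        rewrite eqxx mulr1 addr0 /B -[_ *m N ^+ _]exprD subnKC; last first.
          exact: leq_trans (ltn_ord i) rk.
        over.
      over.
    rewrite exchange_big /=.
    under eq_bigr => l _.
      rewrite -scaler_suml.
      have -> : \sum_(i < r) - b i l * (j%:R ^+ i.+1 / i.+1`!%:R) =
          (j == l.+1 :> nat)%:R.
        have [szW W0 Wj] := WP l.
        have jr : (j <= r)%N by rewrite -ltnS.
        rewrite -(Wj _ jr) (horner_coef_wide _ szW) big_ord_recl /=.
        rewrite -horner_coef0 W0 mul0r add0r; apply: eq_bigr => i _.
        rewrite /b opprK mulrCA mulrA mulrA.
        by rewrite mulrAC mulfK ?pnatr_eq0 -?lt0n ?fact_gt0 // mulrC.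
      over.
    (* The nodes [l.+1] start at 1; time 0 is covered by [f 0 = 0]. *)
    case: (posnP j) => [j0|j0].
      by rewrite j0 f0 mulmx0 big1 // => l _; rewrite scale0r.
    have jr : (j.-1 < r)%N by rewrite prednK // -ltnS.
    rewrite (bigD1 (Ordinal jr)) //= big1 => [|l /negPf lj].
      by rewrite prednK // eqxx scale1r addr0.
    rewrite -val_eqE /= in lj.
    by rewrite -(prednK j0) eqSS eq_sym lj scale0r.
  rewrite /u mulmx_sumr -big_split /=; apply: eq_bigr => i _.
  rewrite mulmx_sumr -big_split /=; apply: eq_bigr => l _.
  rewrite (unipotent_mx_expr _ Nk) mulmx_suml -big_split /=.
  apply: eq_bigr => m _.
  rewrite -scalemxAr -scaler_nat -scalemxAl scalerA /B !mulmxA -scalerDl.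
  by congr (_ *: _); rewrite /c; ring.
have [c cP] := fin_all_exists GP.
exists (\sum_j `|c j|) => n f n0 f0 fP; exists (u n f) => j.
rewrite -ltnS => jr i.
apply: le_trans (cP (Ordinal jr) n f n0 f0 fP i) _.
rewrite ler_wpM2r ?invr_ge0 //.
rewrite (bigD1 (Ordinal jr)) //= (le_trans (ler_norm _)) // lerDl.
exact: sumr_ge0.
Qed.

(** * Affine dynamics: invariant characters, factors, irrationality *)

Lemma strict_between_int (R : numDomainType) (x : R) (m z : int) :
  m%:~R < x < (m + 1)%:~R -> x != z%:~R.
Proof.
move=> /andP[mx xm]; apply/eqP=> xz; move: mx xm; rewrite xz !ltr_int; lia.
Qed.

(** A nonzero row of the last nonvanishing power of [N] works; [0 < d] makes N^0 nonzero. Such a row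
    is a character of the torus fixed by 1 + N. *)
Lemma nilpotent_left_kernel d k (N : 'M[int]_d) : (0 < d)%N -> N ^+ k = 0 ->
  exists2 v : 'rV[int]_d, v != 0 & v *m N = 0.
Proof.
case: d N => // d N _ Nk.
have exk : exists k, N ^+ k == 0 by exists k; apply/eqP.
case: (ex_minnP exk) => -[|m] /eqP Nm minm.
  by have /eqP := Nm; rewrite expr0 oner_eq0.
have : N ^+ m != 0 by apply/negP=> /minm; rewrite ltnn.
move=> Nm0; have [i [j Nij]] : exists i j, (N ^+ m) i j != 0.
  case: (pickP (fun ij => (N ^+ m) ij.1 ij.2 != 0)) => [[i j] Nij|Nm0'].
    by exists i, j.
  case/eqP: Nm0; apply/matrixP=> i j; rewrite mxE.
  by have /negbFE/eqP := Nm0' (i, j).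
exists (row i (N ^+ m)).
  by apply: contraNneq Nij => /rowP/(_ j); rewrite !mxE => ->.
by rewrite -row_mul -[_ *m _]exprSr Nm; apply/rowP=> l; rewrite !mxE.
Qed.

Section Dynamics.
Variable R : archiRealFieldType.

(** Column-vector versions of the given notions, to have matrix algebra at hand. The closed boxes in
    [open_cv] define the usual open sets. *)
Definition aff_map d (M : 'M[int]_d) (a x : 'cV[R]_d) := intr_mx M *m x + a.

Definition open_cv d (U : 'cV[R]_d -> Prop) :=
  forall x, U x -> exists2 e, 0 < e & forall y, cv_le (y - x) e -> U y.

Definition periodic_cv d (U : 'cV[R]_d -> Prop) :=
  forall x z, U x -> U (x + intr_mx z).

Definition minimal_cv d (M : 'M[int]_d) (a : 'cV[R]_d) :=
  forall F : 'cV[R]_d -> Prop, open_cv (fun x => ~ F x) -> periodic_cv F ->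
    (exists x, F x) -> (forall x, F x -> F (aff_map M a x)) -> forall x, F x.

Definition recurrent_cv (Rset : nat -> Prop) r d (M : 'M[int]_d) (a : 'cV[R]_d) :=
  forall U : 'cV[R]_d -> Prop, open_cv U -> periodic_cv U -> (exists x, U x) ->
    exists n, Rset n /\
      exists x, forall j, (j <= r)%N -> U (iter (j * n) (aff_map M a) x).

Lemma iter_aff_mapD d (M : 'M[int]_d) (a x u : 'cV[R]_d) n :
  iter n (aff_map M a) (x + u) =
  iter n (aff_map M a) x + intr_mx M ^+ n *m u.
Proof.
elim: n => [|n IH] /=; first by rewrite expr0 mul1mx.
by rewrite IH /aff_map mulmxDr mulmxA exprS addrAC.
Qed.

Lemma iter_aff_map_intr d (M : 'M[int]_d) (a x : 'cV[R]_d) (z : 'cV[int]_d) n :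
  iter n (aff_map M a) (x + intr_mx z) =
  iter n (aff_map M a) x + intr_mx (M ^+ n *m z).
Proof. by rewrite iter_aff_mapD map_mxM map_mxX. Qed.

Lemma iter_aff_map_factor d d' (P : 'M[int]_(d', d)) M M' (a x : 'cV[R]_d) n :
  P *m M = M' *m P ->
  intr_mx P *m iter n (aff_map M a) x =
  iter n (aff_map M' (intr_mx P *m a)) (intr_mx P *m x).
Proof.
move=> PM; elim: n => //= n <-.
by rewrite /aff_map mulmxDr !mulmxA -!map_mxM PM.
Qed.

Lemma cv_leD d (x y : 'cV[R]_d) e1 e2 :
  cv_le x e1 -> cv_le y e2 -> cv_le (x + y) (e1 + e2).
Proof.
by move=> xe ye i; rewrite mxE (le_trans (ler_normD _ _)) // lerD.
Qed.

Lemma cv_leN d (x : 'cV[R]_d) e : cv_le x e -> cv_le (- x) e.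
Proof. by move=> xe i; rewrite mxE normrN; exact: xe. Qed.

Lemma cv_le_trans d (x : 'cV[R]_d) e1 e2 : cv_le x e1 -> e1 <= e2 -> cv_le x e2.
Proof. by move=> xe e12 i; apply: le_trans (xe i) e12. Qed.

Lemma mulmx_small m d (B : 'M[R]_(m, d)) e : 0 < e ->
  exists2 c, 0 < c & forall c' x, c' <= c -> cv_le x c' -> cv_le (B *m x) e.
Proof.
move=> e0; have [b b0 bP] := cv_le_mulmx B.
have b1 : 0 < b + 1 by lra.
exists (e / (b + 1)) => [|c' x c'c xc]; first exact: divr_gt0.
apply: cv_le_trans (bP _ _ (cv_le_trans xc c'c)) _.
by rewrite mulrCA ler_piMr ?(ltW e0) // ler_pdivrMr // mul1r; lra.
Qed.

Lemma open_preimage m d (B : 'M[R]_(m, d)) (U : 'cV[R]_m -> Prop) :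
  open_cv U -> open_cv (fun x => U (B *m x)).
Proof.
move=> oU x /oU[e e0 eU]; have [c c0 cP] := mulmx_small B e0.
by exists c => // y yx; apply: eU; rewrite -mulmxBr; apply: cP yx.
Qed.

(** Closed invariant sets pull back along [P], which is surjective thanks to the section [S]. *)
Lemma minimal_cv_factor d d' (P : 'M[int]_(d', d)) S M M' (a : 'cV[R]_d) :
  P *m M = M' *m P -> P *m S = 1%:M -> minimal_cv M a ->
  minimal_cv M' (intr_mx P *m a).
Proof.
move=> PM PS minM F cF pF [y Fy] TF.
have PSR z : intr_mx P *m (intr_mx S *m z) = z :> 'cV[R]_d'.
  by rewrite mulmxA -map_mxM PS map_mx1 mul1mx.
suff H : forall x, F (intr_mx P *m x) by move=> x; rewrite -(PSR x); apply: H.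
apply: minM.
- exact: (open_preimage (U := fun x => ~ F x)).
- by move=> x z Fx; rewrite mulmxDr -map_mxM; apply: pF.
- by exists (intr_mx S *m y); rewrite PSR.
- by move=> x /TF; rewrite /aff_map mulmxDr !mulmxA -!map_mxM PM.
Qed.

(** If q v.a were an integer, the x with q v.x an integer would form a closed periodic invariant set
    containing 0, hence everything; but some y has q v.y = 1/2. *)
Lemma minimal_cv_irrational d (M : 'M[int]_d) (a : 'cV[R]_d) (v : 'rV[int]_d) q
    (z : int) :
  minimal_cv M a -> v != 0 -> v *m M = v -> (0 < q)%N ->
  (intr_mx v *m a) 0 0 *+ q != z%:~R.
Proof.
move=> minM v0 vM q0; apply/eqP => aq.
pose L : 'rV[R]_d := q%:R *: intr_mx v.
have LE x : (L *m x) 0 0 = (intr_mx v *m x) 0 0 *+ q.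
  by rewrite -scalemxAl mxE mulr_natl.
pose F (x : 'cV[R]_d) := exists m : int, (L *m x) 0 0 = m%:~R.
have [i vi] : exists i, v 0 i != 0.
  apply/existsP; apply: contraNT v0; rewrite negb_exists => /forallP v0.
  by apply/eqP/rowP=> i; have := v0 i; rewrite mxE negbK => /eqP.
have FT : forall x, F x.
  apply: minM.
  - apply: (@open_preimage _ _ L (fun y => ~ exists m : int, y 0 0 = m%:~R)).
    move=> y yF; set m := Num.floor (y 0 0).
    have /andP[my ym] := floor_itv (y 0 0); rewrite -/m in my ym.
    have {}my : m%:~R < y 0 0.
      by rewrite lt_neqAle my andbT; apply/eqP => my'; apply: yF; exists m.
    exists (Num.min (y 0 0 - m%:~R) ((m + 1)%:~R - y 0 0) / 2).
      by rewrite divr_gt0 // lt_min !subr_gt0 my.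
    move=> x xy [z' xz]; have := xy 0; rewrite !mxE.
    set c := Num.min _ _ => xyc.
    have c1 : c <= y 0 0 - m%:~R by rewrite ge_min lexx.
    have c2 : c <= (m + 1)%:~R - y 0 0 by rewrite ge_min lexx orbT.
    have c0 : 0 < c by rewrite lt_min !subr_gt0 my.
    have /negP[] : x 0 0 != z'%:~R; last by apply/eqP.
    apply: (@strict_between_int _ _ m).
    by move: xyc; rewrite ler_norml; lra.
  - move=> x w [m xm]; exists (m + (v *m w) 0 0 *+ q).
    rewrite mulmxDr mxE xm LE -map_mxM mxE.
    by rewrite intrD rmorphMn.
  - by exists 0, 0; rewrite mulmx0 mxE.
  - move=> x [m xm]; exists (m + z); rewrite /aff_map mulmxDr mxE LE.
    rewrite mulmxA -map_mxM vM -LE xm LE aq.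
    by rewrite intrD.
pose y : 'cV[R]_d := (2 * q%:R * (v 0 i)%:~R)^-1 *: delta_mx i 0.
have [m] := FT y; rewrite LE -scalemxAr mxE -colE !mxE.
have v0' : (v 0 i)%:~R != 0 :> R by rewrite intr_eq0.
have q0' : q%:R != 0 :> R by rewrite pnatr_eq0 -lt0n.
rewrite -mulr_natr => ym.
have : 2^-1 = m%:~R :> R.
  by rewrite -ym; field; rewrite v0' q0'.
have /eqP // : 2^-1 != m%:~R :> R.
by apply: (@strict_between_int _ _ 0); lra.
Qed.

(** Finitely many positive distances to the integers have a positive lower bound; halving each new
    distance keeps the inequality strict. This excludes small positive return times. *)
Lemma irrational_gap (t : R) n0 :
  (forall q (z : int), (0 < q)%N -> t *+ q != z%:~R) ->
  exists2 e, 0 < e & forall n (z : int), (0 < n < n0)%N -> e < `|t *+ n - z%:~R|.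
Proof.
move=> tirr; elim: n0 => [|n0 [e e0 eP]].
  by exists 1 => // n z /andP[].
case: (posnP n0) => [n00|n0p].
  by exists 1 => // n z; rewrite n00; lia.
set m := Num.floor (t *+ n0).
have /andP[mt tm] := floor_itv (t *+ n0); rewrite -/m in mt tm.
have {}mt : m%:~R < t *+ n0 by rewrite lt_neqAle mt andbT eq_sym tirr.
pose c := Num.min e (Num.min (t *+ n0 - m%:~R) ((m + 1)%:~R - t *+ n0) / 2).
have c0 : 0 < c by rewrite lt_min e0 divr_gt0 // lt_min !subr_gt0 mt.
exists c => // n z /andP[npos]; rewrite ltnS leq_eqVlt => /orP[/eqP->|nn0].
  have : c <= Num.min (t *+ n0 - m%:~R) ((m + 1)%:~R - t *+ n0) / 2.
    by rewrite ge_min lexx orbT.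
  have : Num.min (t *+ n0 - m%:~R) ((m + 1)%:~R - t *+ n0) <= t *+ n0 - m%:~R.
    by rewrite ge_min lexx.
  have : Num.min (t *+ n0 - m%:~R) ((m + 1)%:~R - t *+ n0)
    <= (m + 1)%:~R - t *+ n0 by rewrite ge_min lexx orbT.
  have [zm|mz] := lerP z m.
    have : z%:~R <= m%:~R :> R by rewrite ler_int.
    rewrite ltr_normr; lra.
  have : (m + 1)%:~R <= z%:~R :> R by rewrite ler_int; lia.
  rewrite ltr_normr; lra.
by apply: le_lt_trans (eP n z _); rewrite ?npos // ge_min lexx.
Qed.

End Dynamics.

(** * The inductive step *)

Lemma recurrent_cv_step (R : archiRealFieldType) (Rset : nat -> Prop) r k d
    (M : 'M[int]_d) (a : 'cV[R]_d) :
  (0 < r <= k)%N -> (M - 1) ^+ k.+1 = 0 -> minimal_cv M a ->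
  (forall d' (M' : 'M[int]_d') (a' : 'cV[R]_d'), (M' - 1) ^+ d' = 0 ->
     (M' - 1) ^+ k = 0 -> minimal_cv M' a' -> recurrent_cv Rset r M' a') ->
  recurrent_cv Rset r M a.
Proof.
move=> /andP[r0 rk] Nk minM quotR.
(* In dimension 0 all matrices vanish and the hypothesis applies directly; the nonzero [v] below
   needs d > 0. *)
have [d0|d0] := posnP d.
  by subst d; apply: quotR => //; apply/matrixP; case.
set N := M - 1 in Nk.
have [v v0 vN] := nilpotent_left_kernel d0 Nk.
have vM : v *m M = v by rewrite -(subrK 1 M) mulmxDr vN add0r mulmx1.
have [d' [P [S [J [Q [K [PS SPJQ PA AK]]]]]]] := image_torus_quotient R (N ^+ k).
have NM : N ^+ k *m M = M *m N ^+ k.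
  have cNM : GRing.comm N M by rewrite /GRing.comm /N mulrBr mulrBl mulr1 mul1r.
  exact: commr_sym (commrX k (commr_sym cNM)).
(* [J] is [N ^+ k] times [K] over the reals and k >= 1, so [v] kills it; hence [v] factors through
   the quotient ([vSP]). *)
have vJ : v *m J = 0.
  apply: (@intr_mx_inj R); rewrite map_mxM -AK mulmxA -map_mxM map_mx0.
  case: (k) (leq_trans r0 rk) => // k' _.
  by rewrite exprS [v *m _]mulmxA vN mul0mx map_mx0 mul0mx.
(* [M] preserves the image of [N ^+ k], so it descends to the quotient as [M']. *)
have PMJ : P *m M *m J = 0.
  apply: (@intr_mx_inj R); rewrite map_mxM -AK mulmxA -map_mxM map_mx0.
  by rewrite -mulmxA -NM mulmxA PA mul0mx map_mx0 mul0mx.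
have vSP : v *m S *m P = v.
  by rewrite -mulmxA -[RHS]mulmx1 -SPJQ mulmxDr (mulmxA v J) vJ mul0mx addr0.
pose M' := P *m M *m S.
have PM : P *m M = M' *m P.
  rewrite -[LHS]mulmx1 -SPJQ mulmxDr (mulmxA _ J) PMJ mul0mx addr0.
  by rewrite mulmxA.
have PN i : P *m N ^+ i = (M' - 1) ^+ i *m P.
  elim: i => [|i IH]; first by rewrite !expr0 mulmx1 mul1mx.
  rewrite !exprSr -[(M' - 1) ^+ i * _]/(_ *m _) -[N ^+ i * _]/(_ *m _).
  by rewrite mulmxA IH -!mulmxA mulmxBr mulmxBl PM mulmx1 mul1mx.
have N'k : (M' - 1) ^+ k = 0.
  by rewrite -[LHS]mulmx1 -PS mulmxA -PN PA mul0mx.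
have recM' := quotR _ M' (intr_mx P *m a) (nilpotent_mx_expr N'k) N'k
  (minimal_cv_factor PM PS minM).
move=> U oU pU [x0 Ux0]; have [eps eps0 Ueps] := oU _ Ux0.
have NkR : (intr_mx N : 'M[R]_d) ^+ k.+1 = 0 by rewrite -map_mxX Nk map_mx0.
have [C CP] := orbit_correction K rk NkR.
(* [bS] makes lifts by [S] accurate to eps/2; from [n0] on, C/n <= eps/2; [gap] keeps n v.a away
   from the integers for 0 < n < n0; [bw] bounds each of two errors seen by [v] by gap/2. *)
have [bS bS0 bSP] := mulmx_small (intr_mx S) (divr_gt0 eps0 (ltr0Sn R 1)).
pose n0 := Num.bound `|C / (eps / 2)|.
have [gap gap0 gapP] := irrational_gap n0
  (fun q z => @minimal_cv_irrational _ _ M a v q z minM v0 vM).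
have [bw bw0 bwP] := mulmx_small (intr_mx (v *m S)) (divr_gt0 gap0 (ltr0Sn R 1)).
pose del := Num.min bS bw.
have delS : del <= bS by rewrite ge_min lexx.
have delw : del <= bw by rewrite ge_min lexx orbT.
have del0 : 0 < del by rewrite lt_min bS0.
(* Closed boxes of radius strictly below [del] make this periodic neighbourhood of P x0 open. *)
pose V (y : 'cV[R]_d') := exists (z : 'cV[int]_d') e,
  e < del /\ cv_le (y - intr_mx P *m x0 - intr_mx z) e.
have oV : open_cv V.
  move=> y [z [e [e_del ye]]]; exists ((del - e) / 2).
    by rewrite divr_gt0 // subr_gt0.
  move=> y' yy'; exists z, ((del - e) / 2 + e); split; first by lra.
  have -> : y' - intr_mx P *m x0 - intr_mx z =
    (y' - y) + (y - intr_mx P *m x0 - intr_mx z) by rewrite !addrA subrK.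
  exact: cv_leD.
have pV : periodic_cv V.
  move=> y z' [z [e [e_del ye]]]; exists (z' + z), e; split=> //.
  suff -> : y + intr_mx z' - intr_mx P *m x0 - intr_mx (z' + z) =
    y - intr_mx P *m x0 - intr_mx z by [].
  by rewrite map_mxD; apply/matrixP => i j; rewrite !mxE; ring.
have exV : exists y, V y.
  exists (intr_mx P *m x0), 0, 0; split=> // i.
  by rewrite subrr map_mx0 subr0 mxE normr0.
have [n [Rn [y Vy]]] := recM' _ oV pV exV.
(* The gap does not exclude n = 0, but then [x0] never leaves [U]. *)
have [n_0|n_gt0] := posnP n.
  by exists 0%N; split; [rewrite -n_0 | exists x0 => j _; rewrite muln0].
exists n; split=> //.
have [z0 [e0 [e0_del ye0]]] := Vy 0%N isT.
rewrite mul0n /= in ye0.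
(* A lift of [y], up to an integer vector, that stays close to [x0]. *)
pose x := x0 + intr_mx S *m (y - intr_mx P *m x0 - intr_mx z0).
have PSR w : intr_mx P *m (intr_mx S *m w) = w :> 'cV[R]_d'.
  by rewrite mulmxA -map_mxM PS map_mx1 mul1mx.
have Px : intr_mx P *m x = y - intr_mx z0.
  by rewrite mulmxDr PSR; apply/matrixP => i j; rewrite !mxE; ring.
pose X j := iter (j * n) (aff_map M a) x.
have VX j : (j <= r)%N -> V (intr_mx P *m X j).
  move=> /Vy Vyj; rewrite (iter_aff_map_factor _ _ _ PM) Px -map_mxN.
  by rewrite iter_aff_map_intr; apply: pV.
(* Both [x] and [X 1] project near P x0 modulo integers, so a smaller n would put n v.a within [gap]
   of an integer. *)
have n0_n : (n0 <= n)%N.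
  rewrite leqNgt; apply/negP => n_n0.
  have vX m : intr_mx v *m iter m (aff_map M a) x =
      intr_mx v *m x + (intr_mx v *m a) *+ m.
    elim: m => [|m IH] /=; first by rewrite mulr0n addr0.
    by rewrite mulmxDr mulmxA -map_mxM vM IH mulrSr addrA.
  have vP w : intr_mx v *m w = intr_mx (v *m S) *m (intr_mx P *m w) :> 'cV[R]_1.
    by rewrite mulmxA -map_mxM vSP.
  have [z1 [e1 [e1_del Xe1]]] := VX 1%N r0.
  have {}Xe1 := bwP _ _ (le_trans (ltW e1_del) delw) Xe1.
  have {}ye0 := bwP _ _ (le_trans (ltW e0_del) delw) ye0.
  have := gapP n ((v *m S *m z1) 0 0); rewrite n_gt0 n_n0 => /(_ isT).
  have := cv_leD Xe1 (cv_leN ye0) => /(_ 0).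
  rewrite -mulmxBr -splitr => le_gap; apply/negP; rewrite -leNgt.
  apply: le_trans le_gap; rewrite le_eqVlt; apply/orP; left; apply/eqP.
  congr `|_|.
  have -> : intr_mx P *m X 1%N - intr_mx P *m x0 - intr_mx z1 -
     (y - intr_mx P *m x0 - intr_mx z0) =
     intr_mx P *m X 1%N - intr_mx P *m x - intr_mx z1.
    by rewrite Px; apply/matrixP => i j; rewrite !mxE; ring.
  rewrite mulmxBr -map_mxM mulmxBr -!vP /X mul1n vX.
  move: (_ *m x) (intr_mx v *m a) (v *m S *m z1) => p q s.
  by rewrite (addrC p) addrK [in RHS]mxE mulmxnE !mxE.
pose t j := intr_mx Q *m (X j - x0).
(* Fractional parts keep [f] bounded, their integer parts being absorbed by periodicity. The value 0
   at j = 0, required by [orbit_correction], is right since [x] is already near [x0]. *)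
pose f j : 'cV[R]_d := if j is 0%N then 0 else
  \col_i (t j i 0 - (Num.floor (t j i 0))%:~R).
have f1 j : cv_le (f j) 1.
  move=> i; case: j => [|j]; first by rewrite mxE normr0.
  rewrite /f mxE; have /andP[] := floor_itv (t j.+1 i 0).
  by rewrite intrD ler_norml; lra.
have Xf j : (j <= r)%N -> exists z : 'cV[int]_d,
    cv_le (X j - x0 - intr_mx z - intr_mx J *m f j) (eps / 2).
  move=> jr; case: (posnP j) => [->|j0].
    exists 0; rewrite /X mul0n /= map_mx0 mulmx0 !subr0 /x addrAC subrr add0r.
    exact: bSP (le_trans (ltW e0_del) delS) ye0.
  have [z [e [e_del Xe]]] := VX j jr.
  pose fl : 'cV[int]_d := \col_i Num.floor (t j i 0).
  have ft : f j = t j - intr_mx fl.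
    by rewrite /fl /f -(prednK j0); apply/colP => i; rewrite !mxE.
  (* In 1 = S P + J Q, the first summand is integral up to eps/2 by [bS], the second is J f_j plus
     an integer vector. *)
  exists (S *m z + J *m fl).
  have -> : X j - x0 - intr_mx (S *m z + J *m fl) - intr_mx J *m f j =
     intr_mx S *m (intr_mx P *m X j - intr_mx P *m x0 - intr_mx z).
    rewrite -[X j - x0]mul1mx -(map_mx1 (intr : int -> R)) -SPJQ.
    rewrite map_mxD mulmxDl ft /t map_mxD !map_mxM -mulmxBr !mulmxBr !mulmxA.
    by apply/matrixP => i l; rewrite !mxE; ring.
  exact: bSP (le_trans (ltW e_del) delS) Xe.
have [u uP] := CP n f n_gt0 (erefl _) f1.
have Cn : C / n%:R <= eps / 2.
  rewrite ler_pdivrMr ?ltr0n // mulrC -ler_pdivrMr ?divr_gt0 //.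
  apply: le_trans (_ : n0%:R <= _); last by rewrite ler_nat.
  apply: le_trans (ler_norm _) _; apply: ltW.
  exact: archi_boundP (normr_ge0 _).
(* Moving by [u] cancels J f_j up to eps/2; the other eps/2 comes from [Xf]. *)
exists (x + u) => j jr.
have [z Xz] := Xf j jr.
have := cv_leD (cv_le_trans (uP j jr) Cn) Xz; rewrite -splitr.
rewrite -[(intr_mx N) ^+ k]map_mxX AK => Uj.
rewrite iter_aff_mapD -/(X j).
have -> : X j + intr_mx M ^+ (j * n) *m u =
  (X j + intr_mx M ^+ (j * n) *m u - intr_mx z) + intr_mx z by rewrite subrK.
apply: pU; apply: Ueps.
suff <- : (1 + intr_mx N) ^+ (j * n) *m u + intr_mx J *m f j +
    (X j - x0 - intr_mx z - intr_mx J *m f j) =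
    X j + intr_mx M ^+ (j * n) *m u - intr_mx z - x0 by [].
have -> : 1 + intr_mx N = intr_mx M :> 'M[R]_d.
  by rewrite map_mxB map_mx1 addrC subrK.
by apply/matrixP => i l; rewrite !mxE; ring.
Qed.

(** * Transfer between [vecR] and column vectors *)

Definition vec_of_cv d (c : 'cV[R]_d) : vecR d := fun i => c i 0.
Definition cv_of_vec d (x : vecR d) : 'cV[R]_d := \col_i x i.

Lemma cv_of_vecK d : cancel (@cv_of_vec d) (@vec_of_cv d).
Proof. by move=> x; apply: functional_extensionality => i; rewrite /vec_of_cv mxE. Qed.

Lemma vec_of_cvK d : cancel (@vec_of_cv d) (@cv_of_vec d).
Proof. by move=> c; apply/colP => i; rewrite mxE. Qed.

Lemma int_to_RE z : int_to_R z = z%:~R.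
Proof. by case: z => n; rewrite /int_to_R INRE. Qed.

Lemma mxpowE d (N : 'M[int]_d) k : mxpow N k = N ^+ k.
Proof. by elim: k => // k IH; rewrite exprS /mxpow /= -/(mxpow N k) IH. Qed.

Lemma affTE d (M : 'M[int]_d) alpha (x : vecR d) :
  cv_of_vec (affT M alpha x) = aff_map M (cv_of_vec alpha) (cv_of_vec x).
Proof.
apply/colP => i; rewrite !mxE; congr (_ + _).
by apply: eq_bigr => j _; rewrite !mxE int_to_RE.
Qed.

Lemma iter_affTE d (M : 'M[int]_d) alpha (x : vecR d) n :
  cv_of_vec (iter n (affT M alpha) x) =
  iter n (aff_map M (cv_of_vec alpha)) (cv_of_vec x).
Proof. by elim: n => //= n IH; rewrite affTE IH. Qed.

Lemma shiftZE d (x : vecR d) (z : 'I_d -> int) :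
  cv_of_vec (shiftZ x z) = cv_of_vec x + intr_mx (\col_i z i).
Proof. by apply/colP => i; rewrite !mxE -int_to_RE. Qed.

Lemma openR_cv_of d (U : vecR d -> Prop) :
  openR U -> open_cv (fun c => U (vec_of_cv c)).
Proof.
(* Halving passes from the strict inequalities of [openR] to closed boxes. *)
move=> oU x /oU[e [/RltP e0 eU]]; exists (e / 2); first exact: divr_gt0.
move=> y yx; apply: eU => i; apply/RltP; rewrite RabsE RminusE.
have := yx i; rewrite !mxE => /le_lt_trans; apply.
by rewrite ltr_pdivrMr // mulr_natr mulr2n ltrDl.
Qed.

Lemma openR_vec d (V : 'cV[R]_d -> Prop) :
  open_cv V -> openR (fun x => V (cv_of_vec x)).
Proof.
move=> oV x /oV[e e0 eV]; exists e; split; first exact/RltP.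
move=> y yx; apply: eV => i; rewrite !mxE; apply: ltW.
by have /RltP := yx i; rewrite RabsE RminusE.
Qed.

Lemma periodic_cv_of d (U : vecR d -> Prop) :
  periodic U -> periodic_cv (fun c => U (vec_of_cv c)).
Proof.
move=> pU c z Uc.
have -> : vec_of_cv (c + intr_mx z) = shiftZ (vec_of_cv c) (fun i => z i 0).
  apply: (can_inj (@cv_of_vecK d)); rewrite shiftZE !vec_of_cvK.
  by congr (_ + intr_mx _); apply/colP => i; rewrite mxE.
exact: pU.
Qed.

Lemma periodic_vec d (V : 'cV[R]_d -> Prop) :
  periodic_cv V -> periodic (fun x => V (cv_of_vec x)).
Proof. by move=> pV x z Vx; rewrite shiftZE; apply: pV. Qed.

Lemma minimal_affine_cv d (M : 'M[int]_d) alpha :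
  minimal_affine M alpha <-> minimal_cv M (cv_of_vec alpha).
Proof.
split=> minM F cF pF [x Fx] TF.
- have FT : forall y, F (cv_of_vec y).
    apply: minM.
    + exact: (openR_vec (V := fun y => ~ F y)).
    + exact: periodic_vec.
    + by exists (vec_of_cv x); rewrite vec_of_cvK.
    + by move=> y Fy; rewrite affTE; apply: TF.
  by move=> y; rewrite -(vec_of_cvK y).
- have FT : forall c, F (vec_of_cv c).
    apply: minM.
    + exact: (openR_cv_of (U := fun y => ~ F y)).
    + exact: periodic_cv_of.
    + by exists (cv_of_vec x); rewrite cv_of_vecK.
    + by move=> c /TF; rewrite -(cv_of_vecK (affT _ _ _)) affTE vec_of_cvK.
  by move=> y; rewrite -(cv_of_vecK y).
Qed.

Lemma r_recurrent_for_cv Rset r d (M : 'M[int]_d) alpha :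
  r_recurrent_for Rset r M alpha <-> recurrent_cv Rset r M (cv_of_vec alpha).
Proof.
split=> recM U oU pU [x Ux].
- have [|n [Rn [y Uy]]] := recM _ (openR_vec oU) (periodic_vec pU).
    by exists (vec_of_cv x); rewrite vec_of_cvK.
  exists n; split=> //; exists (cv_of_vec y) => j /Uy.
  by rewrite iter_affTE.
- have [|n [Rn [y Uy]]] := recM _ (openR_cv_of oU) (periodic_cv_of pU).
    by exists (cv_of_vec x); rewrite cv_of_vecK.
  exists n; split=> //; exists (vec_of_cv y) => j /Uy.
  by rewrite -[in X in X -> _](vec_of_cvK y) -iter_affTE cv_of_vecK.
Qed.

Theorem mainTheorem14 (s r : nat) (Rset : nat -> Prop) :
  (2 <= s)%N -> (1 <= r)%N -> (r <= s - 1)%N ->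
  recurrence_for_affine Rset r (s - 1) ->
  recurrence_for_affine Rset r s.
Proof.
case: s => // k _ r1; rewrite subn1 /= => rk hyp d M alpha _.
rewrite /k_step mxpowE => Nk /minimal_affine_cv minM.
apply/r_recurrent_for_cv; apply: recurrent_cv_step Nk minM _.
  by rewrite r1.
move=> d' M' a' ud' kM' minM'; rewrite -(vec_of_cvK a') in minM' *.
apply/r_recurrent_for_cv; apply: hyp.
- by rewrite /unipotent mxpowE.
- by rewrite /k_step mxpowE.
- exact/minimal_affine_cv.
Qed.
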